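(* Let $d,m\ge1$, $0\le k\le m-1$, $m-k\le r\le\binom{m+d}{d}$, and let $q\ge d+1$ be a prime power. Let $A=S/I$ be a standard graded Artinian algebra over $\Bbbk$, where $S=\Bbbk[x_1,\dots,x_m]$ and $I\subseteq S$ is a homogeneous ideal, such that $\dim_\Bbbk A_1=m$ and $I$ contains a regular sequence of degree $(\underbrace{d,\dots,d}_{m-k},\underbrace{q,\dots,q}_{k})$. If $\mathrm{EGH}(d^{m-k},q^k)_m$ holds for $A$, then $$\dim_\Bbbk(A_{\le d})\le\binom{m+d}{d}-r\quad\Longrightarrow\quad \dim_\Bbbk(A)\le f^{\mathbb A}_r(d,m,k;q).$$
   Context: $\Bbbk=\overline{\mathbb F}_q$ is an algebraic closure of the field with $q$ elements. $A_i$ denotes the degree-$i$ graded piece of $A$, $A_{\le d}=\bigoplus_{i=0}^dA_i$, and $h_A(i)=\dim_\Bbbk A_i$. A regular sequence of degree $(a_1,\dots,a_m)$ is a regular sequence $(f_1,\dots,f_m)$ of homogeneous elements of $S$ with $\deg f_i=a_i$. Order monomials of $S$ lexicographically with $x_1>x_2>\dots>x_m$. A monomial ideal $J\subseteq S$ is a lex ideal if for every monomial $M\in J$ and every monomial $N$ with $\deg N=\deg M$ and $N>_{\mathrm{lex}}M$ we have $N\in J$. For $a_1\le\dots\le a_m$, a lex-plus-powers ideal of degree $(a_1,\dots,a_m)$ is an ideal of the form $L=(x_1^{a_1},\dots,x_m^{a_m})+J$ with $J$ a lex ideal. ''$\mathrm{EGH}(d^{m-k},q^k)_m$ holds for $A$''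 means: there is a lex-plus-powers ideal $L$ of degree $(\underbrace{d,\dots,d}_{m-k},\underbrace{q,\dots,q}_{k})$ with $h_{S/L}(i)=h_A(i)$ for all $i\ge0$. Let $\mathcal B(d,m,k;q)$ be the set of $(\alpha_1,\dots,\alpha_m)\in\mathbb N^m$ ($\mathbb N$ = non-negative integers) with $0\le\alpha_i\le d-1$ for $1\le i\le m-k$ and $0\le \alpha_j\le q-1$ for $m-k+1\le j\le m$. Let $\Omega'(d,m,k;q)$ be the set of $w=(\alpha_1,\dots,\alpha_m)\in\mathcal B(d,m,k;q)$ with $\sum_j\alpha_j\le d$; it has $\binom{m+d}{d}-(m-k)$ elements. For $1\le s\le|\Omega'(d,m,k;q)|$, let $w'_s(d,m,k;q)$ be the $s$-th largest element of $\Omega'(d,m,k;q)$ in lexicographic order. If $r>m-k$ and $w'_{r-(m-k)}(d,m,k;q)=(\alpha_1,\dots,\alpha_m)$, define $$f_r^{\mathbb A}(d,m,k;q)=\sum_{j=1}^{m-k-1}\alpha_j d^{m-k-j}q^k+\sum_{j=m-k}^m\alpha_j q^{m-j};$$ and define $f^{\mathbb A}_{m-k}(d,m,k;q)=d^{m-k}q^k$. *)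

(* Defs.v *)
From HB Require Import structures.
From mathcomp Require Import all_boot all_order all_algebra.
From mathcomp Require Import mpoly.
From Stdlib Require Import ClassicalEpsilon.

Set Implicit Arguments.
Unset Strict Implicit.
Unset Printing Implicit Defensive.

Import Order.TTheory GRing.Theory.

Local Open Scope ring_scope.

(* Subsets (subspaces, ideals) are Prop-valued predicates: no decidability of
   membership is assumed. *)

(* dimension of the image of U in V / W, i.e. of U / (U :&: W) *)
Section QuotientDimension.
Variables (K : fieldType) (V : lmodType K).
Implicit Types U W : V -> Prop.

Definition qbasis U W n (b : 'I_n -> V) : Prop :=
  [/\ forall i, U (b i),
      forall c : 'I_n -> K, W (\sum_i c i *: b i) -> forall i, c i = 0
    & forall v, U v -> exists c : 'I_n -> K, W (v - \sum_i c i *: b i)].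

Definition has_qdim U W (n : nat) : Prop := exists b : 'I_n -> V, qbasis U W b.

(* unspecified when the quotient is infinite dimensional *)
Definition qdim U W : nat := epsilon (inhabits 0%N) (has_qdim U W).

Lemma qbasis_leq U W n p (b : 'I_n -> V) (b' : 'I_p -> V) :
    W 0 -> (forall a u v, W u -> W v -> W (a *: u + v)) ->
  qbasis U W b -> qbasis U W b' -> (p <= n)%N.
Proof.
move=> W0 WD [_ _ gen] [Ub' free' _].
have WS (I : finType) (a : I -> K) (u : I -> V) :
    (forall i, W (u i)) -> W (\sum_i a i *: u i).
  by move=> Wu; elim/big_rec: _ => // i x _; apply: WD.
have [C HC] : exists C : 'M[K]_(p, n),
    forall j, W (b' j - \sum_i C j i *: b i).
  have /= h j : exists c : {ffun 'I_n -> K}, W (b' j - \sum_i c i *: b i).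
    have [c Hc] := gen _ (Ub' j); exists [ffun i => c i].
    by under eq_bigr do rewrite ffunE.
  exists (\matrix_(j, i) sval (constructive_indefinite_description _ (h j)) i).
  move=> j; under eq_bigr do rewrite mxE.
  exact: svalP (constructive_indefinite_description _ (h j)).
suff /eqP <- : row_free C by rewrite rank_leq_col.
apply/row_freeP; exists (pinvmx C); apply/eqP; rewrite -subr_eq0.
have ker0 (v : 'rV_p) : v *m C = 0 -> v = 0.
  move=> vC; apply/rowP => j; rewrite mxE; move: j; apply: free'.
  suff -> : \sum_j v 0 j *: b' j =
      \sum_j v 0 j *: (b' j - \sum_i C j i *: b i) by apply: WS.
  under [RHS]eq_bigr do rewrite scalerBr.
  rewrite sumrB -[LHS]subr0; congr (_ - _).
  under eq_bigr do rewrite scaler_sumr.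
  rewrite exchange_big /= big1 // => i _.
  under eq_bigr do rewrite scalerA.
  rewrite -scaler_suml; have /rowP/(_ i) := vC; rewrite !mxE => ->.
  by rewrite scale0r.
apply/eqP/row_matrixP => i; rewrite row0; apply: ker0.
by rewrite -row_mul mulmxBl mul1mx mulmxKpV ?subrr ?row0.
Qed.

Lemma qdimE U W n :
    W 0 -> (forall a u v, W u -> W v -> W (a *: u + v)) ->
  has_qdim U W n -> qdim U W = n.
Proof.
move=> W0 WD Un.
have [b' Hb'] := epsilon_spec (inhabits 0%N) _ (ex_intro _ n Un).
have [b Hb] := Un; apply/eqP; rewrite eqn_leq.
by rewrite (qbasis_leq W0 WD Hb Hb') (qbasis_leq W0 WD Hb' Hb).
Qed.

End QuotientDimension.

Section Ideals.
Variables (R : comNzRingType).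
Implicit Types I J G : R -> Prop.

Definition is_ideal I : Prop :=
  [/\ I 0, forall f g, I f -> I g -> I (f + g) & forall h f, I f -> I (h * f)].

Definition ideal_gen G (f : R) : Prop :=
  exists2 s : seq (R * R), {in s, forall x, G x.2}
                         & f = \sum_(x <- s) x.1 * x.2.

Definition ideal_sum I J (f : R) : Prop :=
  exists g h, [/\ I g, J h & f = g + h].

(* R / I is Artinian; ideals of R / I are the ideals of R containing I *)
Definition artinian_quotient I : Prop :=
  forall J : nat -> R -> Prop,
    (forall n, is_ideal (J n)) ->
    (forall n f, I f -> J n f) ->
    (forall n f, J n.+1 f -> J n f) ->
  exists N, forall n f, (N <= n)%N -> (J n f <-> J N f).

Definition regular_sequence m (f : 'I_m -> R) : Prop :=
  (forall (i : 'I_m) g,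
     let prev := ideal_gen (fun h => exists2 j : 'I_m, (j < i)%N & h = f j) in
     prev (f i * g) -> prev g)
  /\ ~ ideal_gen (fun h => exists j, h = f j) 1.

End Ideals.

Section GradedQuotients.
Variables (K : fieldType) (m : nat).
Local Notation S := {mpoly K[m]}.
Implicit Types I J L : S -> Prop.

Definition homogeneous_ideal I : Prop :=
  is_ideal I /\ forall f i, I f -> I (pihomog mdeg i f).

(* h_{S/I}(i) *)
Definition hilbert I (i : nat) : nat := qdim (fun f => f \is i.-homog) I.

(* For I homogeneous, the image of S_{<= d} in S / I is the direct sum of the
   graded pieces of degree at most d. *)
Definition dim_upto I (d : nat) : nat := qdim (fun f => (msize f <= d.+1)%N) I.

Definition dim_quotient I : nat := qdim (fun _ => True) I.

Definition regular_sequence_of_degree (a : 'I_m -> nat) (f : 'I_m -> S) :=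
  (forall i, f i \is (a i).-homog) /\ regular_sequence f.

Definition monomial_ideal J : Prop :=
  exists M : 'X_{1..m} -> Prop,
    forall f, J f <-> ideal_gen (fun g => exists2 u, M u & g = 'X_[u]) f.

(* Lexicographic order on exponent vectors, the first coordinate being the most
   significant; the default order of multinomials on 'X_{1..m} compares degrees
   first. *)
Definition lexm (u : 'X_{1..m}) : m.-tuplelexi nat := multinom_val u.

Lemma lexm_ltP (u v : 'X_{1..m}) :
  reflect (exists2 i : 'I_m, forall j : 'I_m, (j < i)%N -> u j = v j
                           & (u i < v i)%N)
          (lexm u < lexm v)%O.
Proof.
rewrite /lexm; apply: (iffP (@Order.TupleLexiOrder.ltxi_tuplePlt _ _ _ _ _ _)).
  by case=> i Hj; rewrite ltEnat => Hi; exists i => // j /Hj.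
by case=> i Hj Hi; exists i => // j /Hj.
Qed.

Definition lex_ideal J : Prop :=
  monomial_ideal J /\
  forall u v : 'X_{1..m}, J 'X_[u] -> mdeg v = mdeg u ->
    (lexm u < lexm v)%O -> J 'X_[v].

Definition lex_plus_powers (a : 'I_m -> nat) L : Prop :=
  exists2 J, lex_ideal J &
    forall f, L f <->
      ideal_sum (ideal_gen (fun g => exists i, g = 'X_i ^+ a i)) J f.

(* the degree sequence (d, ..., d, q, ..., q) with k entries q *)
Definition dq_degrees (d k q : nat) (i : 'I_m) : nat :=
  if (i < m - k)%N then d else q.

Definition EGH (d k q : nat) I : Prop :=
  exists2 L, lex_plus_powers (dq_degrees d k q) L &
    forall i, hilbert L i = hilbert I i.

End GradedQuotients.

Section Bound.
Local Open Scope nat_scope.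
Variables d m k q : nat.

Definition in_box (w : 'X_{1..m}) : bool :=
  [forall i : 'I_m, w i < dq_degrees d k q i].

Definition Omega' : {set 'X_{1..m < d.+1}} :=
  [set w : 'X_{1..m < d.+1} | in_box w].

(* s-th largest element of Omega', for 1 <= s <= #|Omega'| *)
Definition w' (s : nat) : 'X_{1..m} :=
  nth 0%MM
    (sort (fun u v => (lexm v <= lexm u)%O)
       [seq bmnm w | w <- enum Omega']) s.-1.

(* Ordinals are 0-based: alpha_j is w' s i with j = i.+1. *)
Definition f_affine (r : nat) : nat :=
  if r == m - k then d ^ (m - k) * q ^ k
  else let alpha := w' (r - (m - k)) in
    \sum_(i < m | i.+1 < m - k) alpha i * d ^ (m - k - i.+1) * q ^ k
    + \sum_(i < m | m - k <= i.+1) alpha i * q ^ (m - i.+1).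

End Bound.

(* Main.v *)
(* Let L be the lex-plus-powers ideal given by EGH and W the set of exponents of
   monomials outside L. Since h_{S/L} = h_{S/I}, both dimensions count elements
   of W: all of them for dim A, those of degree at most d for dim A_{<= d}. All
   of W lies in the box B; it is closed under divisors and, in each degree, a
   lexicographically lower segment of B. Put s = r - (m - k), a = w'_s and
   T = {w in B | w <_lex a}. There are at least binom(m+d,d) - r elements of T
   of degree at most d, so W has at most as many of these as T, and one must
   show |W| <= |T|.
   If W contained v of degree d with v >=_lex a, then every element of T of
   degree at most d could be raised, one exponent at a time and without passing
   v, to degree d, hence would be in W, and so is v: contradiction. Otherwise W
   is contained in T in every degree above d, because lowering the last nonzero
   exponent of an element above a of larger degree keeps it above a. Finally
   |T| is at most the mixed radix value of a, which is f_r. *)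
Require Import Defs.
From HB Require Import structures.
From mathcomp Require Import all_boot all_order all_algebra.
From mathcomp Require Import mpoly zify.
From Stdlib Require Import ClassicalEpsilon.

Set Implicit Arguments.
Unset Strict Implicit.
Unset Printing Implicit Defensive.

Import Order.TTheory GRing.Theory.

Local Open Scope ring_scope.

(** * Relative dimension: direct sums and lines *)

Section QuotientDimension.
Variables (K : fieldType) (V : lmodType K).
Implicit Types U W : V -> Prop.

Lemma eq_has_qdim U U' W n :
  (forall v, U v <-> U' v) -> has_qdim U W n -> has_qdim U' W n.
Proof.
move=> UU' [b [Ub free gen]]; exists b; split=> // [i|v /UU']; last exact: gen.
exact/UU'.
Qed.

Lemma has_qdim0 U W : (forall v, U v -> W v) -> has_qdim U W 0.
Proof.
move=> UW; exists (fun=> 0); split=> [[]||v /UW Wv] //; first by move=> c _ [].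
by exists (fun=> 0); rewrite big_ord0 subr0.
Qed.

Variable W : V -> Prop.
Hypotheses (W0 : W 0) (WD : forall a u v, W u -> W v -> W (a *: u + v)).

Let WZ a u : W u -> W (a *: u).
Proof. by move=> /(WD a)/(_ W0); rewrite addr0. Qed.

Let WA u v : W u -> W v -> W (u + v).
Proof. by move=> /(WD 1); rewrite scale1r; apply. Qed.

(** The last hypothesis makes the sum of [U] and [U'] direct modulo [W], so the two bases can be
    concatenated. *)
Lemma has_qdim_sum U U' U'' n p :
    (forall v, U v -> U'' v) -> (forall v, U' v -> U'' v) ->
    (forall v, U'' v -> exists u u', [/\ U u, U' u' & v = u + u']) ->
    (forall c (b : 'I_n -> V), (forall i, U (b i)) -> U (\sum_i c i *: b i)) ->
    (forall c (b : 'I_p -> V), (forall i, U' (b i)) -> U' (\sum_i c i *: b i)) ->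
    (forall u u', U u -> U' u' -> W (u + u') -> W u /\ W u') ->
  has_qdim U W n -> has_qdim U' W p -> has_qdim U'' W (n + p).
Proof.
move=> UU UU' dec US US' ind [b [Ub freeb genb]] [b' [Ub' freeb' genb']].
exists (fun i => match split i with inl j => b j | inr j => b' j end).
have sumE (c : 'I_(n + p) -> K) :
    \sum_i c i *: match split i with inl j => b j | inr j => b' j end
    = \sum_i c (lshift p i) *: b i + \sum_i c (rshift n i) *: b' i.
  rewrite big_split_ord /=; congr (_ + _); apply: eq_bigr => i _.
    by rewrite -[lshift p i]/(unsplit (inl i)) unsplitK.
  by rewrite -[rshift n i]/(unsplit (inr i)) unsplitK.
split=> [i|c|v /dec [u [u' [Uu Uu' ->]]]].
- by case: (split i) => j; [apply: UU|apply: UU'].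
- rewrite sumE => /ind [||Wu Wu' i]; [exact: US|exact: US'|].
  rewrite -(splitK i); case: (split i) => j.
    exact: (freeb (fun j => c (lshift p j))).
  exact: (freeb' (fun j => c (rshift n j))).
have [c Hc] := genb _ Uu; have [c' Hc'] := genb' _ Uu'.
exists (fun i => match split i with inl j => c j | inr j => c' j end).
rewrite sumE opprD addrACA; apply: WA.
  by under eq_bigr => i _ do
    rewrite -[lshift p i]/(unsplit (inl i)) unsplitK.
by under eq_bigr => i _ do
  rewrite -[rshift n i]/(unsplit (inr i)) unsplitK.
Qed.

Lemma has_qdim_line x : ~ W x -> has_qdim (fun v => exists c, v = c *: x) W 1.
Proof.
move=> Wx; exists (fun=> x); split=> [i|c|v [c ->]]; first by exists 1; rewrite scale1r.
  rewrite big_ord1 => Wcx i; rewrite (ord1 i); apply/eqP/negP => /negP c0.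
  by apply: Wx; rewrite -[x]scale1r -(mulVf c0) -scalerA; apply: WZ.
by exists (fun=> c); rewrite big_ord1 subrr.
Qed.

End QuotientDimension.

(** * Spans of finitely many monomials modulo an ideal *)

Section Polynomials.
Variables (K : fieldType) (m : nat).
Local Notation S := {mpoly K[m]}.
Implicit Types (I J L : S -> Prop) (T : seq 'X_{1..m}).

Lemma ideal_linear I : is_ideal I -> forall a u v, I u -> I v -> I (a *: u + v).
Proof.
by case=> I0 ID IM a u v Iu Iv; apply: ID => //; rewrite -mul_mpolyC; apply: IM.
Qed.

Definition supported T (f : S) : Prop := forall w, w \notin T -> f@_w = 0.

Lemma supported_comb T n c (b : 'I_n -> S) :
  (forall i, supported T (b i)) -> supported T (\sum_i c i *: b i).
Proof.
move=> Tb w wT; rewrite raddf_sum big1 //= => i _.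
by rewrite mcoeffZ Tb // mulr0.
Qed.

Lemma supported_cons T x f :
  supported (x :: T) f -> supported T (f - f@_x *: 'X_[x]).
Proof.
move=> Tf w wT; rewrite mcoeffB mcoeffZ mcoeffX.
have [<-|xw] := eqVneq x w; first by rewrite mulr1 subrr.
by rewrite mulr0 subr0 Tf // in_cons eq_sym (negPf xw).
Qed.

Lemma supportedW T x f : supported T f -> supported (x :: T) f.
Proof. by move=> Tf w; rewrite in_cons => /norP[_ /Tf]. Qed.

Variable I : S -> Prop.
Hypothesis idI : is_ideal I.
Let I0 : I 0. Proof. by case: idI. Qed.
Let IL := ideal_linear idI.

(** Replacing [f@_x *: 'X_[x]] by [f@_x *: v] moves [f] into the span of [T] without changing it
    modulo [I], so the old basis still generates. *)
Lemma has_qdim_supported_dep T x v n :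
    supported T v -> I ('X_[x] - v) ->
  has_qdim (supported T) I n -> has_qdim (supported (x :: T)) I n.
Proof.
move=> Tv Ixv [b [Ub freeb genb]]; exists b; split=> // [i|f Tf].
  exact: supportedW.
have [|c Hc] := genb (f - f@_x *: 'X_[x] + f@_x *: v).
  by move=> w wT; rewrite mcoeffD mcoeffZ Tv // mulr0 addr0 (supported_cons Tf).
exists c; have := IL f@_x Ixv Hc; congr I.
by rewrite -[f - _ + _]addrA [- _ + _]addrC -[_ *: v - _]opprB -scalerBr addrA [X in X - _]addrC subrK.
Qed.

Lemma has_qdim_supported_indep T x n :
    (forall v, supported T v -> ~ I ('X_[x] - v)) ->
  has_qdim (supported T) I n -> has_qdim (supported (x :: T)) I n.+1.
Proof.
move=> Tx dimT; rewrite -addn1.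
apply: (has_qdim_sum IL _ _ _ _ _ _ dimT (has_qdim_line (x := 'X_[x]) I0 IL _)).
- by move=> f; apply: supportedW.
- move=> f [c ->] w; rewrite in_cons mcoeffZ mcoeffX => /norP[/negPf].
  by rewrite eq_sym => -> _; rewrite mulr0.
- move=> f Tf; exists (f - f@_x *: 'X_[x]), (f@_x *: 'X_[x]).
  by split; [exact: supported_cons|exists f@_x|rewrite subrK].
- by move=> c b; apply: supported_comb.
- by move=> c b /(_ ord0) [a Hb]; rewrite big_ord1 Hb; exists (c ord0 * a); rewrite scalerA.
(* For nonzero [c], dividing by it would make ['X_[x]] congruent modulo [I] to [- (c^-1 *: u)],
   which lies in the span of [T]. *)
- move=> u _ Tu [c ->]; have [->|c0] := eqVneq c 0.
    by rewrite scale0r addr0.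
  move=> /(IL c^-1)/(_ I0); rewrite addr0 scalerDr scalerA mulVf // scale1r.
  move=> Iuc; case: (Tx (- (c^-1 *: u))); last by rewrite opprK addrC.
  by move=> w wT; rewrite mcoeffN mcoeffZ Tu // mulr0 oppr0.
- by move=> Ix; apply: (Tx 0) => [w _|]; rewrite ?mcoeff0 // subr0.
Qed.

Lemma has_qdim_supported0 : has_qdim (supported [::]) I 0.
Proof.
apply: has_qdim0 => f f0; suff -> : f = 0 by [].
by apply/mpolyP => w; rewrite f0 // mcoeff0.
Qed.

(** [qdim] is a choice by [epsilon], so its value can be used only once some basis is known to
    exist; one is built here monomial by monomial. *)
Lemma has_qdim_supported T : exists n, has_qdim (supported T) I n.
Proof.
elim: T => [|x T [n dimT]]; first by exists 0%N; apply: has_qdim_supported0.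
have [[v [Tv Iv]]|Tx] := classic (exists v, supported T v /\ I ('X_[x] - v)).
  by exists n; apply: has_qdim_supported_dep Iv dimT.
by exists n.+1; apply: has_qdim_supported_indep dimT => v Tv Iv; case: Tx; exists v.
Qed.

Lemma has_qdim_monomial (D : pred 'X_{1..m}) T :
    (forall f, I f <-> {in msupp f, forall w, D w}) -> uniq T ->
  has_qdim (supported T) I (count (predC D) T).
Proof.
move=> ID; elim: T => [_|x T IH /= /andP[xT /IH dimT]].
  exact: has_qdim_supported0.
have [Dx|Dx] := boolP (D x) => /=.
  apply: (has_qdim_supported_dep (v := 0)) dimT => [w _|]; first exact: mcoeff0.
  by apply/ID; rewrite subr0 msuppX => w; rewrite inE => /eqP->.
apply: has_qdim_supported_indep dimT => v Tv /ID /(_ x).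
rewrite mcoeff_msupp mcoeffB mcoeffX eqxx Tv // subr0 oner_eq0 => /(_ isT).
exact/negP.
Qed.

End Polynomials.

(** * Hilbert function and total dimension *)

Section Hilbert.
Variables (K : fieldType) (m : nat).
Local Notation S := {mpoly K[m]}.

Definition monomials N : seq 'X_{1..m} := [seq bmnm w | w : 'X_{1..m < N}].

Lemma mem_monomials N w : (w \in monomials N) = (mdeg w < N)%N.
Proof.
apply/imageP/idP => [[v _ ->]|wN]; first exact: bmdeg.
by exists (BMultinom wN).
Qed.

Lemma monomials_uniq N : uniq (monomials N).
Proof. by rewrite map_inj_uniq ?enum_uniq //; apply: val_inj. Qed.

Lemma supported_homog i (f : S) :
  supported [seq w <- monomials i.+1 | mdeg w == i] f <-> f \is i.-homog.
Proof.
split=> [Tf|/dhomog_nemf_coeff fi w].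
  apply/dhomogP => w; rewrite mcoeff_msupp; apply: contraNeq => wi.
  by apply/eqP/Tf; rewrite mem_filter (negPf wi).
by rewrite mem_filter mem_monomials ltnS; case: ltngtP => //= wi _;
  apply: fi; rewrite neq_ltn wi // orbT.
Qed.

Lemma supported_msize N (f : S) : supported (monomials N) f <-> (msize f <= N)%N.
Proof.
split=> [Tf|fN w].
  rewrite msizeE; apply/bigmax_leqP_seq => w; rewrite mcoeff_msupp => wf _.
  by rewrite -mem_monomials; apply: contraNT wf => /Tf->.
rewrite mem_monomials -leqNgt => Nw; apply: memN_msupp_eq0.
exact/msize_mdeg_ge/(leq_trans fN).
Qed.

Lemma mcoeff_pihomog i (f : S) w :
  (pihomog mdeg i f)@_w = if mdeg w == i then f@_w else 0.
Proof.
rewrite pihomogE raddf_sum /=; under eq_bigr do rewrite mcoeffZ mcoeffX.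
have [wf|/memN_msupp_eq0 wf] := boolP (w \in msupp f).
  rewrite big_mkcond (bigD1_seq w) //= eqxx mulr1 big1 ?addr0 // => v /negPf->.
  by rewrite mulr0 if_same.
rewrite big1 => [|v _]; first by rewrite wf if_same.
by have [->|] := eqVneq v w; rewrite ?wf ?mul0r ?mulr0.
Qed.

Variable I : S -> Prop.
Hypothesis hI : homogeneous_ideal I.
Let idI := hI.1.
Let I0 : I 0. Proof. by case: idI. Qed.
Let IL := ideal_linear idI.

Lemma has_qdim_hilbert i : has_qdim (fun f => f \is i.-homog) I (hilbert I i).
Proof.
have [n /(eq_has_qdim (@supported_homog i)) dimi] :=
  has_qdim_supported idI [seq w <- monomials i.+1 | mdeg w == i].
by rewrite /hilbert (qdimE I0 IL dimi).
Qed.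

(** [msize f <= N] means degree below [N]; the induction step adds the forms of degree [N]. That sum
    is direct modulo [I] because a homogeneous ideal contains the degree [N] component of each of
    its elements. *)
Lemma has_qdim_msize N :
  has_qdim (fun f => (msize f <= N)%N) I (\sum_(i < N) hilbert I i).
Proof.
elim: N => [|N IH].
  by rewrite big_ord0; apply: has_qdim0 => f; rewrite leqn0 msize_poly_eq0 => /eqP->.
have homS i n c (b : 'I_n -> S) :
    (forall j, b j \is i.-homog) -> \sum_j c j *: b j \is i.-homog.
  by move=> hb; apply: rpred_sum => j _; apply: rpredZ.
rewrite big_ord_recr; apply: (has_qdim_sum IL _ _ _ _ _ _ IH (has_qdim_hilbert N)).
- by move=> f fN; apply: leqW.
- move=> f /dhomogP fN; rewrite msizeE; apply/bigmax_leqP_seq => w /fN wN _.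
  by rewrite ltnS wN.
- move=> f fN; exists (f - pihomog mdeg N f), (pihomog mdeg N f).
  split; [|exact: pihomogP|by rewrite subrK].
  apply/supported_msize => w; rewrite mem_monomials -leqNgt => Nw.
  rewrite mcoeffB mcoeff_pihomog; case: eqP => [|/eqP wN]; first by rewrite subrr.
  rewrite subr0; apply/memN_msupp_eq0/msize_mdeg_ge/(leq_trans fN).
  by rewrite ltn_neqAle eq_sym wN.
- by move=> c b hb; apply/supported_msize/supported_comb => i; apply/supported_msize.
- by move=> c b; apply: homS.
- move=> u u' uN u'N Iuu'; have Iu' : I u'.
    have := hI.2 _ N Iuu'; rewrite pihomogD (pihomog_dE u'N).
    suff -> : pihomog mdeg N u = 0 by rewrite add0r.
    apply/mpolyP => w; rewrite mcoeff_pihomog mcoeff0; case: eqP => // wN.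
    by apply/memN_msupp_eq0/msize_mdeg_ge; rewrite wN.
  split=> //; have := IL (-1) Iu' Iuu'; congr I.
  by rewrite scaleN1r addrC addrK.
Qed.

Lemma dim_uptoE N : dim_upto I N = (\sum_(i < N.+1) hilbert I i)%N.
Proof. by rewrite /dim_upto (qdimE I0 IL (has_qdim_msize _)). Qed.

(** Above degree [N] all forms lie in [I], so [f] is congruent to the sum of its components of
    degree at most [N], and a basis for these serves for the whole quotient. *)
Lemma dim_quotientE N :
  (forall i, (N < i)%N -> hilbert I i = 0%N) -> dim_quotient I = dim_upto I N.
Proof.
move=> h0; rewrite dim_uptoE; apply: (qdimE I0 IL).
have [b [Ub freeb genb]] := has_qdim_msize N.+1.
exists b; split=> // f _.
have If i : (N < i)%N -> I (pihomog mdeg i f).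
  move=> Ni; have := has_qdim_hilbert i; rewrite h0 // => -[c [_ _ gen]].
  by have [|a] := gen (pihomog mdeg i f); rewrite ?pihomogP // big_ord0 subr0.
have [c Hc] : exists c, I ((\sum_(i < N.+1) pihomog mdeg i f) - \sum_i c i *: b i).
  apply: genb; apply/supported_msize => w; rewrite mem_monomials -leqNgt => Nw.
  rewrite raddf_sum big1 //= => i _; rewrite mcoeff_pihomog gtn_eqF //.
  exact: leq_trans (ltn_ord i) Nw.
exists c.
(* Both sums of components are written over the common range below [maxn (msize f) N.+1]. *)
have fE := pihomog_partitionE (leq_maxl (msize f) N.+1).
rewrite (big_ord_widen_cond (maxn (msize f) N.+1) xpredT
  (fun i => pihomog mdeg i f)) ?leq_maxr // in Hc.
rewrite [X in I (X - _)]fE (bigID (fun i : 'I_ _ => i < N.+1)%N) /=.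
rewrite addrAC addrC -[X in X + _]scale1r; apply: IL => //.
elim/big_rec: _ => // i u Ni Iu; rewrite -[pihomog _ _ _]scale1r; apply: IL => //.
by apply: If; rewrite ltnNge -ltnS.
Qed.

End Hilbert.

(** * Ideals spanned by the monomials with exponents in a set [D] *)

Section MonomialIdeal.
Variables (K : fieldType) (m : nat).
Local Notation S := {mpoly K[m]}.
Variables (L : S -> Prop) (D : pred 'X_{1..m}).
Hypotheses (idL : is_ideal L) (LD : forall f, L f <-> {in msupp f, forall w, D w}).

Lemma monomial_homogeneous : homogeneous_ideal L.
Proof.
split=> // f i /LD Lf; apply/LD => w; rewrite mcoeff_msupp mcoeff_pihomog.
by case: ifP => _; rewrite ?eqxx // -mcoeff_msupp; apply: Lf.
Qed.

Lemma monomial_dim_upto N : dim_upto L N = count (predC D) (monomials m N.+1).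
Proof.
case: (idL) => L0 _ _; apply: (qdimE L0 (ideal_linear idL)).
apply: (eq_has_qdim (@supported_msize _ _ N.+1)).
exact: (has_qdim_monomial idL LD (monomials_uniq m N.+1)).
Qed.

Lemma monomial_hilbert_eq0 i :
  (forall w, mdeg w = i -> D w) -> hilbert L i = 0%N.
Proof.
move=> Di; case: (idL) => L0 _ _; apply: (qdimE L0 (ideal_linear idL)).
apply: has_qdim0 => f /dhomogP fi; apply/LD => w /fi; exact: Di.
Qed.

End MonomialIdeal.

(** * Lexicographic order inside a box *)

Section LexOrder.
Variable m : nat.
Implicit Types u v w : 'X_{1..m}.

Lemma lexm_inj : injective (@lexm m).
Proof. exact: val_inj. Qed.

Lemma mdeg_mono u v : (u <= v)%MM -> (mdeg u <= mdeg v)%N.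
Proof. by move/lem_leo/lemc_mdeg. Qed.

(** Take [j] to be the last nonzero exponent of [v]. If [v - U_(j)] fell below [u], first at [i],
    then either [i < j] and [v] itself is below [u], or [v - U_(j) + U_(i)] divides [u] and
    [mdeg v <= mdeg u]. *)
Lemma lexm_lower u v : (lexm u <= lexm v)%O -> (mdeg u < mdeg v)%N ->
  exists2 j, (0 < v j)%N & (lexm u <= lexm (v - U_(j))%MM)%O.
Proof.
move=> uv deg_uv; have [i0 vi0] : exists i, v i != 0%N.
  apply/existsP; apply: contraLR deg_uv; rewrite negb_exists -leqNgt => /forallP v0.
  by rewrite mdegE big1 // => i _; apply/eqP; have := v0 i; rewrite negbK.
have [j vj jmax] := arg_maxnP (P := fun i => v i != 0%N) (fun i : 'I_m => i : nat) vi0.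
exists j; first by rewrite lt0n.
rewrite leNgt; apply/negP => /lexm_ltP[i eq_lt lt_i].
have [ij|ji] := ltnP i j.
  move: uv; rewrite leNgt => /negP; apply; apply/lexm_ltP; exists i => [l li|].
    by have := eq_lt _ li; rewrite mnmBE mnm1E -val_eqE /= gtn_eqF ?subn0 ?(ltn_trans li).
  by move: lt_i; rewrite mnmBE mnm1E -val_eqE /= gtn_eqF ?subn0.
have /mdeg_mono : (v - U_(j) + U_(i) <= u)%MM.
  apply/mnm_lepP => l; rewrite mnmDE mnm1E.
  case: (ltngtP l i) => [li|il|/val_inj ->].
  - by rewrite eq_lt // -val_eqE /= gtn_eqF ?addn0.
  - have /eqP : v l == 0%N.
      by apply: contraLR il; rewrite -leqNgt => /jmax /leq_trans; apply.
    by rewrite mnmBE => ->; rewrite -val_eqE /= ltn_eqF.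
  - by rewrite eqxx addn1.
have vE : (v - U_(j) + U_(j))%MM = v by rewrite submK // lep1mP.
by move: deg_uv; rewrite -{1}vE !mdegD !mdeg1 => /leq_trans h /h; rewrite ltnn.
Qed.

Variable b : nat -> nat.

Definition box w := [forall i : 'I_m, (w i < b i)%N].

(* Raise the last exponent if the box allows it; otherwise u is concentrated in
   the last variable and the first exponent at which u and v differ can be raised. *)
Lemma lexm_raise u v : (mdeg v <= b m.-1)%N -> box u -> box v ->
    (mdeg u < mdeg v)%N -> (lexm u < lexm v)%O ->
  exists2 j, box (u + U_(j))%MM & (lexm (u + U_(j))%MM <= lexm v)%O.
Proof.
move=> hb /forallP bu /forallP bv deg_uv /lexm_ltP[i eq_i lt_i].
have m_gt0 : (m.-1 < m)%N by case: (m) i {eq_i lt_i} => // -[].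
pose l := Ordinal m_gt0.
have le_l (j : 'I_m) : (j <= l)%N by have := ltn_ord j; rewrite /=; lia.
(* If the raised [u] passed [v], it would do so at some [j] beyond [i] with [u j] positive, hence at
   [l]. Then [v] agrees with the raised [u] off [l] and is smaller at [l], which forces
   [mdeg v <= mdeg u]. *)
have raise_i (bi : forall j : 'I_m, (i < j)%N -> (j < l)%N -> u j = 0%N) :
    exists2 j, box (u + U_(j))%MM & (lexm (u + U_(j))%MM <= lexm v)%O.
  exists i.
    apply/forallP => j; rewrite mnmDE mnm1E; have [<-|_] := eqVneq i j.
      by rewrite addn1 (leq_ltn_trans lt_i).
    by rewrite addn0.
  rewrite leNgt; apply/negP => /lexm_ltP[j eq_j]; rewrite mnmDE mnm1E => lt_j.
  have ij : (i < j)%N.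
    rewrite ltnNge leq_eqVlt; apply/negP => /orP[/eqP/val_inj ji|ji].
      by move: lt_j; rewrite ji eqxx; lia.
    by move: lt_j; rewrite eq_i // -val_eqE /= gtn_eqF // addn0 ltnn.
  move: lt_j; rewrite -val_eqE /= ltn_eqF // addn0 => lt_j.
  have jl : j = l.
    apply/val_inj/eqP; rewrite eqn_leq le_l leqNgt; apply/negP => /bi - /(_ ij) uj.
    by move: lt_j; rewrite uj.
  move: deg_uv; rewrite !mdegE (bigD1 j) // [X in (_ < X)%N](bigD1 j) //=.
  rewrite ltnNge => /negP; apply.
  have : (\sum_(t | t != j) v t <= \sum_(t | t != j) (u + U_(i))%MM t)%N.
    apply: leq_sum => t tj; rewrite eq_j // ltn_neqAle tj jl; exact: le_l.
  under [X in (_ <= X)%N -> _]eq_bigr do rewrite mnmDE.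
  rewrite big_split /= [X in (_ <= _ + X)%N -> _](bigD1 i) ?mnm1E ?eqxx /=; last first.
    by rewrite -val_eqE /= ltn_eqF.
  rewrite [X in (_ <= _ + (_ + X))%N -> _]big1 => [|t /andP[_ ti]]; last by rewrite mnm1E eq_sym (negPf ti).
  by lia.
have [ul|ul] := ltnP (u l).+1 (b l).
  have [li|il] := leqP l i.
    by apply: raise_i => j ij jl; have := leq_trans jl li; rewrite ltnNge (ltnW ij).
  exists l; last first.
    apply/ltW/lexm_ltP; exists i => [j ji|]; rewrite mnmDE mnm1E -val_eqE /=.
      by rewrite gtn_eqF ?addn0 ?eq_i // (ltn_trans ji il).
    by rewrite gtn_eqF ?addn0.
  apply/forallP => j; rewrite mnmDE mnm1E; have [<-|_] := eqVneq l j.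
    by rewrite addn1.
  by rewrite addn0.
(* Here [u l + 1 >= b l >= mdeg v > mdeg u], so [u l] accounts for the whole degree of [u] and the
   other exponents vanish. *)
apply: raise_i => j ij jl; move: deg_uv; rewrite mdegE (bigD1 l) //= (bigD1 j) /=.
  by move: ul hb => /=; lia.
by rewrite -val_eqE /= ltn_eqF.
Qed.


(** * Comparison of a lower family [W] with the part [T] of the box below [a] *)

Section Compare.
Variables (d : nat) (W : pred 'X_{1..m}) (a : 'X_{1..m}).
Hypotheses (hb : (d <= b m.-1)%N) (da : (mdeg a <= d)%N).
Hypothesis Wbox : forall w, W w -> box w.
Hypothesis Wdown : forall u v, (u <= v)%MM -> W v -> W u.
Hypothesis Wlex : forall u v,
  box u -> mdeg u = mdeg v -> (lexm u < lexm v)%O -> W v -> W u.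

Let T := [pred w | box w & (lexm w < lexm a)%O].

Lemma lex_below_top v u : W v -> mdeg v = d -> box u -> (mdeg u <= d)%N ->
  (lexm u <= lexm v)%O -> W u.
Proof.
move=> Wv dv; have [n] := ubnP (d - mdeg u); elim: n u => // n IH u un bu du.
rewrite le_eqVlt => /orP[/eqP/lexm_inj -> //|uv].
move: du; rewrite leq_eqVlt => /orP[/eqP du|du].
  by apply: Wlex uv Wv; rewrite ?du.
have [||j buj uvj] := lexm_raise _ bu (Wbox Wv) _ uv; rewrite ?dv //.
apply: (@Wdown _ (u + U_(j))%MM); first exact: lem_addr.
by apply: IH => //; rewrite mdegD mdeg1; lia.
Qed.

Lemma lex_descend w : W w -> (d <= mdeg w)%N -> (lexm a <= lexm w)%O ->
  exists v, [/\ W v, mdeg v = d & (lexm a <= lexm v)%O].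
Proof.
have [n] := ubnP (mdeg w); elim: n w => // n IH w wn Ww.
rewrite leq_eqVlt => /orP[/eqP dw aw|dw aw]; first by exists w; split.
have [j wj awj] := lexm_lower aw (leq_ltn_trans da dw).
have wE : (w - U_(j) + U_(j))%MM = w by rewrite submK // lep1mP -lt0n.
move: (wE) => /(congr1 (@mdeg _)); rewrite mdegD mdeg1 => degw.
by apply: IH awj; [lia|apply: Wdown Ww; apply: lem_subr|lia].
Qed.

Lemma count_lex_le N : (d <= N)%N ->
    (count W (monomials m d.+1) <= count T (monomials m d.+1))%N ->
  (count W (monomials m N.+1) <= count T (monomials m N.+1))%N.
Proof.
move=> dN; have [[v [Wv dv av]]|Wa] := classic
    (exists v, [/\ W v, mdeg v = d & (lexm a <= lexm v)%O]).
  (* In this case [v] and all elements of [T] of degree at most [d] lie in [W], while [v] is not in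
     [T]: [W] would have strictly more such elements than [T]. *)
  rewrite leqNgt -!size_filter => /negP[].
  apply: (@uniq_leq_size _ (v :: filter T _)).
    by rewrite /= filter_uniq ?monomials_uniq // mem_filter /= ltNge av andbF.
  move=> u; rewrite in_cons !mem_filter !mem_monomials => /predU1P[->|].
    by rewrite Wv dv leqnn.
  case/andP => /andP[bu ua] du; rewrite du andbT.
  by apply: lex_below_top Wv dv bu du _; apply/ltW/(lt_le_trans ua).
have split_count (P : pred 'X_{1..m}) : count P (monomials m N.+1) =
    (count P (monomials m d.+1) + count [pred w | P w & d < mdeg w]%N (monomials m N.+1))%N.
  rewrite -!size_filter -(count_predC (fun w => mdeg w <= d)%N [seq w <- _ | P w]).
  rewrite -!size_filter -!filter_predI; congr (_ + _)%N.
    apply/perm_size/uniq_perm; rewrite ?filter_uniq ?monomials_uniq // => w.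
    rewrite !mem_filter /= !mem_monomials !ltnS andbAC andbC; case: leqP; lia.
  by congr size; apply: eq_filter => w /=; rewrite ltnNge andbC.
rewrite (split_count W) (split_count T) => /leq_add; apply; apply: sub_count => w /= /andP[Ww dw].
rewrite dw (Wbox Ww) andbT /= ltNge; apply/negP => aw.
by apply: Wa; apply: lex_descend Ww (ltnW dw) aw.
Qed.

End Compare.

(* The value of w as a mixed radix numeral with digit bounds b, most significant
   digit first; on the box it is the lexicographic position. *)
Definition box_rank w := (\sum_(i < m) w i * \prod_(i.+1 <= j < m) b j)%N.

(** Induction on the number [m - n] of digits: the digit at [n] is at most [b n - 1], and the
    remaining tail is worth less than one of its units. *)
Lemma box_rank_tail w n : box w -> (n <= m)%N ->
  (\sum_(i < m | n <= i) w i * \prod_(i.+1 <= j < m) b j < \prod_(n <= j < m) b j)%N.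
Proof.
move=> /forallP bw; have [t] := ubnP (m - n); elim: t n => // t IH n nt nm.
move: nm; rewrite leq_eqVlt => /orP[/eqP ->|nm].
  by rewrite big_geq // big1 // => i; rewrite leqNgt ltn_ord.
rewrite (bigD1 (Ordinal nm)) //= [X in (_ < X)%N]big_ltn //.
apply: (@leq_trans ((w (Ordinal nm)).+1 * \prod_(n.+1 <= j < m) b j)); last first.
  by rewrite leq_mul2r (bw (Ordinal nm)) orbT.
rewrite mulSn addnC ltn_add2r.
rewrite (eq_bigl (fun i : 'I_m => n < i)%N); first by apply: IH (nm); lia.
by move=> i; rewrite -val_eqE /= ltn_neqAle eq_sym andbC.
Qed.

Lemma box_rank_lt_prod w : box w -> (box_rank w < \prod_(0 <= j < m) b j)%N.
Proof. by move=> bw; apply: leq_trans (box_rank_tail bw (leq0n m)). Qed.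

(** At the first difference [v] gains at least one unit, which outweighs the later digits of [u] by
    [box_rank_tail]. *)
Lemma box_rank_lt u v : box u -> (lexm u < lexm v)%O -> (box_rank u < box_rank v)%N.
Proof.
move=> bu /lexm_ltP[i eq_i lt_i]; rewrite /box_rank.
rewrite (bigID (fun j : 'I_m => i < j)%N) /= [X in (_ < X)%N](bigID (fun j : 'I_m => i < j)%N) /=.
rewrite [X in (_ + X < _)%N](bigD1 i) ?ltnn //= [X in (_ < _ + X)%N](bigD1 i) ?ltnn //=.
under [X in (_ + (_ + X) < _)%N]eq_bigr => j /andP[ji ne_ji].
  rewrite eq_i; last by rewrite ltn_neqAle ne_ji leqNgt.
  over.
rewrite addnA [X in (_ < X)%N]addnA ltn_add2r; apply: ltn_addl.
apply: (@leq_trans ((u i).+1 * \prod_(i.+1 <= j < m) b j)); last by rewrite leq_mul2r lt_i orbT.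
by rewrite mulSn ltn_add2r box_rank_tail.
Qed.

Lemma count_le_box_rank (P : pred 'X_{1..m}) N f :
  (forall w, P w -> box w && (box_rank w < f)%N) -> (count P (monomials m N) <= f)%N.
Proof.
move=> Pf; rewrite -size_filter -(size_map box_rank) -[leqRHS](size_iota 0).
apply: uniq_leq_size => [|r /mapP[w]]; last first.
  by rewrite mem_filter mem_iota => /andP[/Pf/andP[_ ?] _] ->.
rewrite map_inj_in_uniq ?filter_uniq ?monomials_uniq // => u v.
rewrite !mem_filter => /andP[/Pf/andP[bu _] _] /andP[/Pf/andP[bv _] _] uv.
apply: lexm_inj; case: (ltgtP (lexm u) (lexm v)) => // lt_uv.
  by have := box_rank_lt bu lt_uv; rewrite uv ltnn.
by have := box_rank_lt bv lt_uv; rewrite uv ltnn.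
Qed.

End LexOrder.

(** * Generated ideals and sums of ideals *)

Section IdealGen.
Variable R : comNzRingType.
Implicit Types I J G : R -> Prop.

Lemma ideal_gen_mem G x : G x -> ideal_gen G x.
Proof.
move=> Gx; exists [:: (1, x)]; first by move=> y /[!inE] /eqP->.
by rewrite big_seq1 mul1r.
Qed.

Lemma ideal_gen_ideal G : is_ideal (ideal_gen G).
Proof.
split=> [|_ _ [s Gs ->] [t Gt ->]|h _ [s Gs ->]].
- by exists [::]; rewrite ?big_nil.
- exists (s ++ t); last by rewrite big_cat.
  by move=> x; rewrite mem_cat => /orP[/Gs|/Gt].
- exists [seq (h * x.1, x.2) | x <- s]; first by move=> _ /mapP[x /Gs Gx ->].
  by rewrite big_map mulr_sumr; apply: eq_bigr => x _; rewrite mulrA.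
Qed.

Lemma ideal_sum_ideal I J : is_ideal I -> is_ideal J -> is_ideal (ideal_sum I J).
Proof.
move=> [I0 ID IM] [J0 JD JM]; split.
- by exists 0, 0; rewrite addr0.
- move=> _ _ [g [h [Ig Jh ->]]] [g' [h' [Ig' Jh' ->]]].
  by exists (g + g'), (h + h'); rewrite addrACA; split; [apply: ID|apply: JD|].
- move=> x _ [g [h [Ig Jh ->]]].
  by exists (x * g), (x * h); rewrite mulrDr; split; [apply: IM|apply: JM|].
Qed.

Lemma eq_is_ideal I J : (forall f, I f <-> J f) -> is_ideal J -> is_ideal I.
Proof.
move=> IJ [J0 JD JM]; split; first exact/IJ.
  by move=> f g /IJ Jf /IJ Jg; apply/IJ/JD.
by move=> h f /IJ Jf; apply/IJ/JM.
Qed.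

End IdealGen.

(** * Exponents of a lex-plus-powers ideal *)

Section LexPlusPowers.
Variables (K : fieldType) (m : nat).
Local Notation S := {mpoly K[m]}.
Implicit Types (I J L : S -> Prop) (G : 'X_{1..m} -> Prop).

Lemma ideal_msupp I f : is_ideal I -> {in msupp f, forall w, I 'X_[w]} -> I f.
Proof.
move=> idI If; rewrite [f]mpolyE big_seq; case: (idI) => I0 ID IM.
elim/big_rec: _ => // w g /If Iw Ig; exact: (ideal_linear idI).
Qed.

Lemma ideal_mpolyX_le I (u w : 'X_{1..m}) :
  is_ideal I -> (u <= w)%MM -> I 'X_[u] -> I 'X_[w].
Proof. by case=> _ _ IM /submK <-; rewrite mpolyXD; apply: IM. Qed.

Lemma msupp_ideal_gen (A : S -> Prop) G f :
    (forall g, A g -> exists2 u, G u & g = 'X_[u]) -> ideal_gen A f ->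
  {in msupp f, forall w, exists2 u, G u & (u <= w)%MM}.
Proof.
move=> AG [s As ->] w; rewrite mcoeff_msupp raddf_sum /=.
have [/hasP[x xs xw] _|/hasPn s0] := boolP (has (fun x => (x.1 * x.2)@_w != 0) s).
  have [u Gu x2] := AG _ (As _ xs); exists u => //.
  move: xw; rewrite x2 -mcoeff_msupp (perm_mem (msuppMX _ _)) => /mapP[v _ ->].
  exact: lem_addr.
by rewrite big_seq big1 ?eqxx // => x /s0; rewrite negbK => /eqP.
Qed.

(** Counting needs boolean predicates, whereas membership in an ideal is a proposition; classical
    logic bridges the two. *)
Lemma pred_of_Prop T (P : T -> Prop) : exists D : pred T, forall x, D x <-> P x.
Proof.
exists (fun x => if excluded_middle_informative (P x) then true else false) => x.
by case: excluded_middle_informative.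
Qed.

(** Every monomial of an element of [L] is a multiple of some ['X_i ^+ a i] or lies in [J]. When all
    exponents are below [a] only the second case remains, so there [D] inherits the lex property of
    [J]. *)
Lemma lex_plus_powersP (a : 'I_m -> nat) L : lex_plus_powers a L ->
  exists D : pred 'X_{1..m},
    [/\ is_ideal L, forall f, L f <-> {in msupp f, forall w, D w},
        forall u v, (u <= v)%MM -> D u -> D v,
        forall (w : 'X_{1..m}) i, (a i <= w i)%N -> D w
      & forall u v : 'X_{1..m}, (forall i, u i < a i)%N -> D u -> mdeg v = mdeg u ->
          (lexm u < lexm v)%O -> D v].
Proof.
move=> [J [[M JM] lexJ] LJ].
have idL : is_ideal L.
  apply/(eq_is_ideal LJ)/ideal_sum_ideal; first exact: ideal_gen_ideal.
  exact/(eq_is_ideal JM)/ideal_gen_ideal.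
have [D DP] := pred_of_Prop (fun w => L 'X_[w]).
have JL f : J f -> L f.
  by move=> Jf; apply/LJ; exists 0, f; split; rewrite ?add0r //;
    case: (ideal_gen_ideal (fun g : S => exists i, g = 'X_i ^+ a i)).
have LX i : L 'X_[U_(i) *+ a i].
  apply/LJ; exists 'X_[U_(i) *+ a i], 0; split; last by rewrite addr0.
    by apply: ideal_gen_mem; exists i; rewrite mpolyXn.
  by apply/JM; case: (ideal_gen_ideal (fun g : S => exists2 u, M u & g = 'X_[u])).
have Lsupp f w : L f -> w \in msupp f ->
    (exists i, a i <= w i)%N \/ J 'X_[w].
  move=> /LJ[g [h [gP /JM hJ ->]]]; rewrite mcoeff_msupp mcoeffD => gh.
  have [gw|gw] := eqVneq g@_w 0.
    have [||u Mu uw] := msupp_ideal_gen (G := M) (x := w) _ hJ => //.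
      by rewrite mcoeff_msupp; move: gh; rewrite gw add0r.
    right; apply: ideal_mpolyX_le uw _; first exact/(eq_is_ideal JM)/ideal_gen_ideal.
    by apply/JM/ideal_gen_mem; exists u.
  left; have [||_ [i ->] /mnm_lepP/(_ i)] := msupp_ideal_gen
    (G := fun u => exists i, u = (U_(i) *+ a i)%MM) (x := w) _ gP.
  - by move=> _ [i ->]; exists (U_(i) *+ a i)%MM; [exists i|rewrite mpolyXn].
  - by rewrite mcoeff_msupp.
  - by rewrite mulmnE mnm1E eqxx mul1n; exists i.
have pow (w : 'X_{1..m}) i : (a i <= w i)%N -> L 'X_[w].
  move=> aw; apply: ideal_mpolyX_le (LX i) => //; apply/mnm_lepP => j.
  by rewrite mulmnE mnm1E; have [<-|] := eqVneq i j; rewrite ?mul1n ?mul0n.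
exists D; split=> //.
- move=> f; split=> [Lf w /(Lsupp _ _ Lf)[[i aw]|/JL Lw]|Df]; [|exact/DP|].
    exact/DP/pow/aw.
  by apply: ideal_msupp => // w /Df /DP.
- by move=> u v uv /DP Lu; apply/DP/(ideal_mpolyX_le _ uv).
- by move=> w i aw; apply/DP/pow/aw.
- move=> u v ua /DP Lu deg_uv uv; apply/DP/JL.
  have [||[i]|Ju] := Lsupp 'X_[u] u => //; first by rewrite msuppX inE.
    by rewrite leqNgt ua.
  exact: lexJ uv.
Qed.

End LexPlusPowers.

(** * The box with bounds [d] and [q], and the exponents [w'] *)

Section Bound.
Local Open Scope nat_scope.
Variables d m k q : nat.

(** [dq_degrees] indexed by natural numbers, as [box] requires. *)
Definition dq_bound (j : nat) : nat := if j < m - k then d else q.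

Lemma prod_dq_bound n : n <= m ->
  \prod_(n <= j < m) dq_bound j = d ^ (m - k - n) * q ^ (minn k (m - n)).
Proof.
have [t] := ubnP (m - n); elim: t n => // t IH n nt nm.
move: nm; rewrite leq_eqVlt => /orP[/eqP ->|nm].
  by rewrite big_geq // subnn minn0 (eqP (_ : m - k - m == 0)) //; lia.
rewrite big_ltn // IH ?nm //; last by lia.
rewrite /dq_bound; case: ltnP => nmk.
  by rewrite mulnA -expnS; congr (_ ^ _ * _ ^ _); lia.
rewrite mulnCA -expnS; congr (_ ^ _ * _ ^ _); lia.
Qed.

(** Identifies the rank with the sums in [f_affine]. The index with [i.+1 = m - k] falls in the
    second sum: its weight [q ^ k] has no factor [d]. *)
Lemma box_rank_dq (w : 'X_{1..m}) : box_rank dq_bound w =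
  \sum_(i < m | i.+1 < m - k) w i * d ^ (m - k - i.+1) * q ^ k
  + \sum_(i < m | m - k <= i.+1) w i * q ^ (m - i.+1).
Proof.
rewrite /box_rank (bigID (fun i : 'I_m => i.+1 < m - k)) /=; congr (_ + _).
  apply: eq_bigr => i im; rewrite prod_dq_bound // mulnA; congr (_ * _ ^ _); lia.
apply: eq_big => [i|i im]; first by rewrite -leqNgt.
rewrite prod_dq_bound // (_ : m - k - i.+1 = 0) ?mul1n; last by lia.
by congr (_ * _ ^ _); lia.
Qed.

Lemma size_monomials_ge : 'C(m + d, d) <= size (monomials m d.+1).
Proof.
rewrite -bin_sub ?leq_addl // addnK -card_partial_ord_partitions cardE.
set A := enum _.
pose f (t : m.-tuple 'I_d.+1) := [multinom nat_of_ord (tnth t i) | i < m].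
rewrite -(size_map f); apply: uniq_leq_size.
  rewrite map_inj_uniq ?enum_uniq // => s t /mnmP st; apply: eq_from_tnth => i.
  by apply: val_inj; have := st i; rewrite !mnmE.
move=> _ /mapP[t tA ->]; rewrite mem_monomials ltnS mdegE.
move: tA; rewrite mem_enum inE big_tuple; apply: leq_trans; apply: leq_sum => i _.
by rewrite mnmE.
Qed.

(** Since [d < q], an exponent vector of degree at most [d] leaves the box only by having entry [d]
    at one of the first [m - k] places and zeros elsewhere. *)
Lemma count_in_box_ge : d < q ->
  'C(m + d, d) - (m - k) <= count (box dq_bound) (monomials m d.+1).
Proof.
move=> dq; rewrite leq_subLR (leq_trans size_monomials_ge) //.
rewrite -(count_predC (box dq_bound)) addnC leq_add2r -size_filter.
pose f j := [multinom (if i == j :> nat then d else 0) | i < m].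
rewrite -[leqRHS](size_iota 0) -(size_map f); apply: uniq_leq_size.
  exact/filter_uniq/monomials_uniq.
move=> w; rewrite mem_filter mem_monomials ltnS => /andP[/forallPn[i]].
rewrite -leqNgt /dq_bound => bw wd.
have wE : mdeg w = w i + \sum_(j | j != i) w j by rewrite mdegE (bigD1 i).
case: ltnP bw => [im bw|_ bw]; last by lia.
have w0 : \sum_(j | j != i) w j == 0 by lia.
apply/mapP; exists (i : nat); first by rewrite mem_iota; lia.
apply/mnmP => j; rewrite mnmE; case: eqVneq => [/val_inj ->|ij]; first by lia.
by move: w0; rewrite sum_nat_eq0 => /forallP/(_ j); rewrite -val_eqE ij => /eqP.
Qed.

Definition Omega_sorted : seq 'X_{1..m} :=
  sort (fun u v => (lexm v <= lexm u)%O) [seq bmnm w | w <- enum (Omega' d m k q)].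

Lemma perm_Omega_sorted :
  perm_eq Omega_sorted (filter (box dq_bound) (monomials m d.+1)).
Proof.
rewrite /Omega_sorted perm_sort /monomials filter_map; apply: perm_map.
apply: uniq_perm => [||w]; [exact: enum_uniq|exact/filter_uniq/enum_uniq|].
by rewrite mem_enum inE [RHS]mem_filter mem_enum andbT.
Qed.

Lemma mdeg_w' s : 0 < s <= size Omega_sorted -> mdeg (w' d m k q s) <= d.
Proof.
case/andP=> s0 ss; have ss1 : s.-1 < size Omega_sorted by lia.
have : w' d m k q s \in Omega_sorted by apply: mem_nth ss1.
by rewrite (perm_mem perm_Omega_sorted) mem_filter mem_monomials => /andP[].
Qed.

(** [w'] at [s] has index [s.-1] in the decreasing list, so the entries from index [s] on, which
    [drop] retains, are strictly below it. *)
Lemma count_below_w' s : 0 < s <= size Omega_sorted ->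
  size Omega_sorted - s <=
    count [pred w | box dq_bound w & (lexm w < lexm (w' d m k q s))%O] (monomials m d.+1).
Proof.
case/andP=> s0 ss; rewrite -size_drop -size_filter.
have uO : uniq Omega_sorted.
  by rewrite (perm_uniq perm_Omega_sorted) filter_uniq ?monomials_uniq.
apply: uniq_leq_size; first exact: drop_uniq.
move=> w wO; have := mem_drop wO.
rewrite (perm_mem perm_Omega_sorted) !mem_filter /= => /andP[-> ->]; rewrite andbT /=.
have [i] := nthP 0%MM wO; rewrite size_drop nth_drop => iO <-.
have ss1 : s.-1 < size Omega_sorted by lia.
have si : s + i < size Omega_sorted by rewrite -ltn_subRL.
rewrite -[w' _ _ _ _ _]/(nth 0%MM Omega_sorted s.-1).
rewrite lt_neqAle (inj_eq (@lexm_inj m)) nth_uniq //.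
apply/andP; split; first by lia.
have tr : transitive (fun u v : 'X_{1..m} => (lexm v <= lexm u)%O).
  by move=> v u t vu /le_trans; apply.
apply: (sorted_ltn_nth tr); rewrite ?inE //; last by lia.
by apply: sort_sorted => u v; apply: le_total.
Qed.

End Bound.

Theorem proposition3p1 (d m k r q : nat)
    (hd : (1 <= d)%N) (hm : (1 <= m)%N) (hk : (k <= m - 1)%N)
    (hr : (m - k <= r <= 'C(m + d, d))%N)
    (hq : exists p e : nat, [/\ prime p, (0 < e)%N & q = (p ^ e)%N])
    (hdq : (d + 1 <= q)%N)
    (* K is an algebraic closure, via iota, of the field F with q elements *)
    (F : finFieldType) (hF : #|F| = q)
    (K : closedFieldType) (iota : {rmorphism F -> K})
    (hK : forall x : K, algebraicOver iota x)
    (I : {mpoly K[m]} -> Prop)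
    (hI : homogeneous_ideal I)
    (hArt : artinian_quotient I)
    (hA1 : hilbert I 1 = m)
    (hreg : exists2 f : 'I_m -> {mpoly K[m]},
       regular_sequence_of_degree (dq_degrees d k q) f & forall i, I (f i))
    (hEGH : EGH d k q I) :
  (dim_upto I d <= 'C(m + d, d) - r)%N ->
  (dim_quotient I <= f_affine d m k q r)%N.
Proof.
have dq : (d < q)%N by rewrite -addn1.
have km : (k < m)%N by lia.
have [L /lex_plus_powersP[D [idL LD Dup Dpow Dlex]] hilbL] := hEGH.
have Dbox w : ~~ D w -> box (dq_bound d m k q) w.
  apply: contraNT => /forallPn[i]; rewrite -leqNgt; exact: Dpow.
have dimI N : dim_upto I N = count (predC D) (monomials m N.+1).
  rewrite -(monomial_dim_upto idL LD) !dim_uptoE //; last exact: monomial_homogeneous LD.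
  exact: eq_bigr.
(* The degree bound [m * q] comes from the box: its [m] exponents are all below [q], so every
   monomial of larger degree lies in [L]. *)
have dimIq : dim_quotient I = dim_upto I (m * q).
  apply: dim_quotientE => // i mqi; rewrite -hilbL.
  apply: (monomial_hilbert_eq0 idL LD) => w wi; apply: contraLR mqi => /Dbox/forallP bw.
  rewrite -leqNgt -wi mdegE -[m in (m * q)%N]card_ord -sum_nat_const; apply: leq_sum => j _.
  by apply: ltnW; apply: leq_trans (bw j) _; rewrite /dq_bound; case: ifP => // _; apply: ltnW.
rewrite dimIq !dimI /f_affine => dimd; case: ifP => [_|r_mk].
  (* For [r = m - k] the bound is the size of the whole box. *)
  apply: (count_le_box_rank (b := dq_bound d m k q)) => w /Dbox bw; rewrite bw; apply: leq_trans (box_rank_lt_prod bw) _.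
  rewrite prod_dq_bound //; apply/eq_leq; congr (_ ^ _ * _ ^ _)%N; lia.
set s := (r - (m - k))%N; set a := w' _ _ _ _ _.
have sizeO := perm_size (perm_Omega_sorted d m k q).
have geO : ('C(m + d, d) - (m - k) <= size (Omega_sorted d m k q))%N.
  by rewrite sizeO size_filter; apply: count_in_box_ge.
have sO : (0 < s <= size (Omega_sorted d m k q))%N by rewrite /s; lia.
rewrite -box_rank_dq //.
have dmq : (d <= m * q)%N by apply: (leq_trans (ltnW dq)); apply: leq_pmull.
apply: leq_trans (count_lex_le (b := dq_bound d m k q) (a := a) _ _ _ _ _ dmq _) _.
- by rewrite /dq_bound; case: ifP => // _; apply: ltnW.
- exact: mdeg_w'.
- exact: Dbox.
- by move=> u v uv; apply: contra; apply: Dup.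
- move=> u v bu duv uv; apply: contra => Du.
  by apply: (Dlex u) => // i; have /forallP := bu; apply.
(* As [r] is the sum of [m - k] and [s], the bound on [dim_upto] is at most the size of
   [Omega_sorted] minus [s], by [geO]. *)
- apply: (leq_trans dimd);  apply: (leq_trans _ (count_below_w' sO)); rewrite /s; lia.
by apply: (count_le_box_rank (b := dq_bound d m k q)) => w /= /andP[bw wa]; rewrite bw box_rank_lt.
Qed.
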